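(* Let $H_1,\dots,H_\ell,H'_1,\dots,H'_m$ be complete multipartite graphs, let $k_1,\dots,k_\ell$ be positive integers, and let $\alpha_1,\dots,\alpha_\ell\ge 0$ and $\beta_1,\dots,\beta_m\ge 0$ be reals. For a graph $G$ let $$x(G):=\sum_{i=1}^\ell \alpha_i\,\mathcal{N}_{\mathrm{re}}(H_i,K_{k_i+1},G)+\sum_{j=1}^m\beta_j\, \mathcal{N}(H'_j,G).$$ Then for every $n$, among all $n$-vertex graphs $G$, $x(G)$ is maximized by some complete multipartite graph $T$.
   Context: All graphs are finite and simple. A copy of a graph $H$ in a graph $G$ is a (not necessarily induced) subgraph of $G$ isomorphic to $H$; $\mathcal{N}(H,G)$ is the number of copies of $H$ in $G$. Two subgraphs $G'$ and $G''$ of $G$ align in $G$ if $V(G')\subseteq V(G'')$ or $V(G'')\subseteq V(G')$. $\mathcal{N}_{\mathrm{re}}(H,F,G)$ denotes the number of copies of $H$ in $G$ that do not align with any copy of $F$ in $G$. *)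

(* Defs.v *)
From mathcomp Require Import all_boot all_order all_algebra.
From mathcomp Require Import reals.

Set Implicit Arguments.
Unset Strict Implicit.
Unset Printing Implicit Defensive.

Record sgraph := SGraph {
  svertex :> finType;
  sedge : rel svertex;
  sedge_sym : symmetric sedge;
  sedge_irrefl : irreflexive sedge }.

(* The parts are nonempty, and any number of them is allowed: an edgeless graph
   has one part, a complete graph has singleton parts, and the graph without
   vertices has no part. *)
Definition complete_multipartite (G : sgraph) : bool :=
  [exists P : {set {set G}},
    partition P [set: G] &&
    [forall x : G, forall y : G, sedge x y == (pblock P x != pblock P y)]].

Section CompleteGraph.
Variable n : nat.

Definition complete_rel : rel 'I_n := fun x y => x != y.

Lemma complete_rel_sym : symmetric complete_rel.
Proof. by move=> x y; rewrite /complete_rel eq_sym. Qed.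

Lemma complete_rel_irrefl : irreflexive complete_rel.
Proof. by move=> x; rewrite /complete_rel eqxx. Qed.

Definition complete_graph : sgraph := SGraph complete_rel_sym complete_rel_irrefl.

End CompleteGraph.

Section Copies.
Variable G : sgraph.

(* A candidate subgraph is a vertex set together with a set of edges, an edge
   being the unordered pair of its ends. *)
Definition subgraph : Type := ({set G} * {set {set G}})%type.

Definition is_subgraph (S : subgraph) : bool :=
  [forall e in S.2,
    exists x in S.1, exists y in S.1, sedge x y && (e == [set x; y])].

Definition subgraph_iso (H : sgraph) (S : subgraph) : bool :=
  [exists f : {ffun H -> G},
    [&& injectiveb f, f @: [set: H] == S.1 &
        [forall x : H, forall y : H, sedge x y == ([set f x; f y] \in S.2)]]].

Definition copies (H : sgraph) : {set subgraph} :=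
  [set S : subgraph | is_subgraph S && subgraph_iso H S].

Definition align (S S' : subgraph) : bool :=
  (S.1 \subset S'.1) || (S'.1 \subset S.1).

End Copies.

Definition ncopies (H G : sgraph) : nat := #|copies G H|.

Definition ncopies_re (H F G : sgraph) : nat :=
  #|[set S in copies G H | [forall S' in copies G F, ~~ align S S']]|.

(* Main.v *)
Require Import Defs.
From mathcomp Require Import all_boot all_order all_algebra.
From mathcomp Require Import reals perm.
From mathcomp Require Import zify lra.

Set Implicit Arguments.
Unset Strict Implicit.
Unset Printing Implicit Defensive.

Import Order.TTheory GRing.Theory Num.Theory.
Local Open Scope ring_scope.

(* Zykov symmetrization.  For nonadjacent u and v, let G[u->v] be G with u
   turned into a clone of v.  A copy of a complete multipartite graph through
   both u and v has them in the same part, hence survives in G[u->v] and in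
   G[v->u]; a copy through v only survives in G[u->v] together with its mirror
   image through u.  As no clique contains both u and v, unaligned copies stay
   unaligned, so 2 x(G) <= x(G[u->v]) + x(G[v->u]).  Take G maximizing x and,
   among the maximizers, the number of edges.  Then G[u->v] is again such a
   graph and u, v have equal degrees.  If v were adjacent to neither end of an
   edge uw, then in G[u->v] the degree of w would have dropped by one and the
   degree of v would not have changed, a contradiction; so nonadjacency is
   transitive. *)

(** * Complete multipartite graphs through non-adjacency *)

(** The parts are the classes of non-adjacency; the condition is the contrapositive of its
    transitivity. *)
Lemma complete_multipartiteP (G : sgraph) :
  reflect (forall x y z : G, sedge x y -> sedge x z || sedge z y)
          (complete_multipartite G).
Proof.
apply: (iffP existsP) => [[P /andP[_ /forallP eP]] x y z | trG].
  have eE a b : sedge a b = (pblock P a != pblock P b).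
    by move/forallP: (eP a) => /(_ b)/eqP.
  rewrite !eE => xy; apply: contraR xy.
  by rewrite negb_or !negbK => /andP[/eqP-> /eqP->].
pose R := [rel x y : G | ~~ sedge x y].
have eqR : {in [set: G] & &, equivalence_rel R}.
  move=> x y z _ _ _; rewrite /= sedge_irrefl; split=> // nxy.
  apply/idP/idP; apply: contra.
    by move=> /(trG _ _ x); rewrite (sedge_sym y) (negPf nxy).
  by move=> /(trG _ _ y); rewrite (negPf nxy).
exists (equivalence_partition R [set: G]).
rewrite equivalence_partitionP //=.
apply/forallP => x; apply/forallP => y.
have covx z : z \in cover (equivalence_partition R [set: G]).
  by rewrite (cover_partition (equivalence_partitionP eqR)) inE.
have tI := partition_trivIset (equivalence_partitionP eqR).
rewrite eq_pblock // pblock_equivalence_partition ?inE //=.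
by rewrite negbK.
Qed.

(** * Turning a vertex into a clone of another *)

Section CloneRelation.
Variables (V : finType) (u v : V) (e : rel V).

Definition retarget (x : V) : V := if x == u then v else x.

Definition clone : rel V := fun x y => e (retarget x) (retarget y).

Lemma clone_sym : symmetric e -> symmetric clone.
Proof. by move=> e_sym x y; apply: e_sym. Qed.

Lemma clone_irr : irreflexive e -> irreflexive clone.
Proof. by move=> e_irr x; apply: e_irr. Qed.

(** Both [u] and [v] go to [v]; hence swapping them is an automorphism of the clone. *)
Lemma retarget_tperm x : retarget (tperm u v x) = retarget x.
Proof.
rewrite /retarget; case: tpermP => [-> | -> | _ _] //; rewrite eqxx;
  by case: eqP.
Qed.

End CloneRelation.

(** * Unaligned copies and their behaviour under cloning *)

Section UnalignedCopies.
Variables (H : sgraph) (k : nat).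
Implicit Types (V W : finType).

Definition copy_of V (f : H -> V) : {set V} * {set {set V}} :=
  (f @: [set: H],
   [set [set f p.1; f p.2] | p in [set p : H * H | sedge p.1 p.2]]).

(** With a bare relation on [V], the copies in a graph and in its clones have the same type and can
    be compared as sets. *)
Definition is_copy V (e : rel V) (S : {set V} * {set {set V}}) : bool :=
  [exists f : {ffun H -> V}, [&& injectiveb f, S == copy_of f &
     [forall x, forall y, sedge x y ==> e (f x) (f y)]]].

Definition is_clique V (e : rel V) (K : {set V}) : bool :=
  (#|K| == k.+1) && [forall x in K, forall y in K, (x != y) ==> e x y].

(** Alignment sees only vertex sets, so cliques stand in for copies of a complete graph. *)
Definition unaligned V (e : rel V) (A : {set V}) : bool :=
  [forall K : {set V}, is_clique e K ==> ~~ ((A \subset K) || (K \subset A))].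

Definition unaligned_copies V (e : rel V) : {set {set V} * {set {set V}}} :=
  [set S | is_copy e S && unaligned e S.1].

Lemma is_copyP V (e : rel V) S :
  reflect (exists f : H -> V, [/\ injective f, S = copy_of f &
             forall x y, sedge x y -> e (f x) (f y)]) (is_copy e S).
Proof.
apply: (iffP existsP) => [[f /and3P[/injectiveP fI /eqP-> /forallP fe]] |
    [f [fI -> fe]]].
  by exists f; split=> // x y; move/forallP: (fe x) => /(_ y)/implyP.
exists [ffun x => f x].
have fE : [ffun x => f x] =1 f by move=> x; rewrite ffunE.
apply/and3P; split.
- by apply/injectiveP => x y; rewrite !fE => /fI.
- rewrite /copy_of xpair_eqE; apply/andP; split; apply/eqP.
    by apply: eq_imset => x; rewrite fE.
  by apply: eq_imset => x; rewrite !fE.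
- by apply/forallP => x; apply/forallP => y; apply/implyP; rewrite !fE => /fe.
Qed.

Lemma is_cliqueP V (e : rel V) (K : {set V}) :
  reflect (#|K| = k.+1 /\ {in K &, forall x y, x != y -> e x y})
          (is_clique e K).
Proof.
apply: (iffP andP) => [[/eqP-> /forall_inP eK] | [-> eK]]; split=> //.
  by move=> x y xK yK; move/forall_inP: (eK x xK) => /(_ y yK)/implyP.
apply/forall_inP => x xK; apply/forall_inP => y yK.
by apply/implyP; apply: eK.
Qed.

Lemma unalignedP V (e : rel V) (A : {set V}) :
  reflect (forall K : {set V}, is_clique e K ->
             ~~ (A \subset K) /\ ~~ (K \subset A)) (unaligned e A).
Proof.
apply: (iffP forallP) => eA K; last first.
  by apply/implyP => /eA[]; rewrite negb_or => -> ->.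
by move=> cK; move: (eA K); rewrite cK negb_or => /andP[].
Qed.

Section Isomorphism.
Variables (V W : finType) (e : rel V) (e' : rel W) (g : V -> W).
Hypotheses (g_bij : bijective g) (g_mor : forall x y, e' (g x) (g y) = e x y).

Definition map_copy (S : {set V} * {set {set V}}) : {set W} * {set {set W}} :=
  (g @: S.1, [set g @: (a : {set V}) | a in S.2]).

Lemma map_copy_of (f : H -> V) : map_copy (copy_of f) = copy_of (g \o f).
Proof.
by rewrite /map_copy /copy_of /= -!imset_comp; congr (_, _);
   apply: eq_imset => p /=; rewrite imsetU1 imset_set1.
Qed.

Lemma map_copy_inj : injective map_copy.
Proof.
have gI := bij_inj g_bij.
move=> [A E] [B F] /= [/(imset_inj gI)-> /(imset_inj (imset_inj gI))->].
by [].
Qed.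

Lemma is_copy_map S : is_copy e S -> is_copy e' (map_copy S).
Proof.
move=> /is_copyP[f [fI -> fe]]; apply/is_copyP; exists (g \o f); split.
- exact: inj_comp (bij_inj g_bij) fI.
- exact: map_copy_of.
- by move=> x y /fe /=; rewrite g_mor.
Qed.

Lemma unaligned_map A : unaligned e A -> unaligned e' (g @: A).
Proof.
have gI := bij_inj g_bij; have [h gK hK] := g_bij.
move=> /unalignedP eA; apply/unalignedP => K /is_cliqueP[cK eK].
have KE : K = g @: (g @^-1: K).
  apply/setP => y; apply/idP/imsetP => [yK|[x]]; last by rewrite inE => ? ->.
  by exists (h y); rewrite ?inE hK.
have [] := eA (g @^-1: K).
  apply/is_cliqueP; split; first by rewrite -cK [in RHS]KE card_imset.
  move=> x y; rewrite !inE => xK yK xy.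
  by rewrite -g_mor eK // (inj_eq gI).
move=> nAK nKA; split; first by rewrite sub_imset_pre.
apply: contra nKA => /subsetP KA; apply/subsetP => x.
by rewrite inE => /KA; rewrite mem_imset.
Qed.

Lemma unaligned_copies_map S :
  S \in unaligned_copies e -> map_copy S \in unaligned_copies e'.
Proof.
by rewrite !inE => /andP[/is_copy_map-> /unaligned_map].
Qed.

Lemma leq_unaligned_copies :
  (#|unaligned_copies e| <= #|unaligned_copies e'|)%N.
Proof.
rewrite -(card_imset _ map_copy_inj); apply/subset_leq_card/subsetP => S1.
by move=> /imsetP[S Se ->]; apply: unaligned_copies_map.
Qed.

End Isomorphism.

Section Clone.
Variables (V : finType) (e : rel V) (u v : V).
Implicit Types (S : {set V} * {set {set V}}) (A : {set V}).
Hypotheses (e_sym : symmetric e) (e_irr : irreflexive e).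
Hypotheses (uv : u != v) (e_uv : ~~ e u v).
Hypothesis H_multipartite : complete_multipartite H.

(** Only edges at [u] can be lost. If [u] is in the copy, so is [v], and their preimages in [H] are
    non-adjacent, hence have the same neighbours; thus [v] already has every edge that [u] needs. *)
Lemma is_copy_clone S :
  (u \in S.1 -> v \in S.1) -> is_copy e S -> is_copy (clone u v e) S.
Proof.
move=> uvS /is_copyP[f [fI SE fe]]; apply/is_copyP; exists f; split=> //.
have twin x y : f x = u -> sedge x y -> e v (f y).
  move=> fx xy; have /imsetP[z _ vE]: v \in f @: [set: H].
    by move: uvS; rewrite SE; apply; rewrite -fx imset_f.
  have [/fe|/fe] := orP (complete_multipartiteP _ H_multipartite x y z xy).
    by rewrite -vE fx (negPf e_uv).
  by rewrite -vE.
move=> x y xy; rewrite /clone /retarget.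
have [fxu|fxu] := eqVneq (f x) u; have [fyu|fyu] := eqVneq (f y) u.
- by move: xy; rewrite (fI x y) ?sedge_irrefl // fxu.
- exact: twin fxu xy.
- by rewrite e_sym (twin y x) // sedge_sym.
- exact: fe.
Qed.

(** A clique of the clone through [u] misses [v]; replacing [u] by [v] in it gives a clique of [e]
    of the same size, and any inclusion with [A] carries over. *)
Lemma unaligned_clone A :
  (u \in A -> v \in A) -> unaligned e A -> unaligned (clone u v e) A.
Proof.
move=> uvA /unalignedP eA; apply/unalignedP => K /is_cliqueP[cK eK].
have [uK|uK] := boolP (u \in K); last first.
  apply: eA; apply/is_cliqueP; split=> // x y xK yK /(eK x y xK yK).
  by rewrite /clone /retarget !ifN //; apply: contraNneq uK => <-.
have vK : v \notin K.
  apply/negP => vK; move: (eK u v uK vK uv).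
  by rewrite /clone /retarget eqxx eq_sym (negPf uv) e_irr.
have rI : {in K &, injective (retarget u v)}.
  move=> x y xK yK; rewrite /retarget.
  have [->|xu] := eqVneq x u; have [->|yu] := eqVneq y u => // xy.
    by move: vK; rewrite xy yK.
  by move: vK; rewrite -xy xK.
have [|nAK nKA] := eA (retarget u v @: K).
  apply/is_cliqueP; rewrite card_in_imset //; split=> //.
  move=> _ _ /imsetP[x xK ->] /imsetP[y yK ->] xy; apply: eK => //.
  by apply: contraNneq xy => ->.
split; [apply: contra nAK | apply: contra nKA] => /subsetP sub.
  have uA : u \notin A by apply: contra vK => /uvA/sub.
  apply/subsetP => x xA; apply/imsetP; exists x; first exact: sub.
  by rewrite /retarget ifN //; apply: contraNneq uA => <-.
apply/subsetP => _ /imsetP[x xK ->]; rewrite /retarget.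
by case: eqP => _; [apply: uvA; apply: sub | apply: sub].
Qed.

Lemma unaligned_copies_clone S : S \in unaligned_copies e ->
  (u \in S.1 -> v \in S.1) -> S \in unaligned_copies (clone u v e).
Proof.
rewrite !inE => /andP[cS uS] uvS.
by rewrite is_copy_clone // unaligned_clone.
Qed.

(** Copies in the first set survive unchanged. Those in the second also yield their images under the
    swap of [u] and [v], which contain [u] but not [v] and so are not in the first set. *)
Lemma leq_unaligned_copies_clone :
  (#|[set S in unaligned_copies e | (u \in S.1) ==> (v \in S.1)]|
   + #|[set S in unaligned_copies e | (v \in S.1) && (u \notin S.1)]|
   <= #|unaligned_copies (clone u v e)|)%N.
Proof.
have tB : bijective (tperm u v) by exists (tperm u v); apply: tpermK.
have t_mor x y :
    clone u v e (tperm u v x) (tperm u v y) = clone u v e x y.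
  by rewrite /clone !retarget_tperm.
set X := [set S in _ | _]; set Y := [set S in _ | _].
rewrite -(card_imset Y (map_copy_inj tB)) -cardsUI.
(* The intersection term vanishes by this disjointness, shown last. *)
rewrite [X in (_ + X)%N]eq_card0 ?addn0.
  apply/subset_leq_card/subsetP => S; rewrite inE => /orP[|/imsetP[T]].
    by rewrite inE => /andP[Se /implyP]; apply: unaligned_copies_clone.
  rewrite inE => /and3P[Te _ uT] ->.
  apply: (unaligned_copies_map tB t_mor); apply: unaligned_copies_clone => //.
  by rewrite (negPf uT).
move=> S; rewrite [RHS]inE; apply/negP => /setIP[+ /imsetP[T]].
rewrite inE => /andP[_ +] + SE; rewrite SE !inE /map_copy /=.
move=> + /and3P[_ vT uT]; rewrite -[X in X \in _](tpermR u v) mem_imset ?vT;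
  last exact: perm_inj.
rewrite -[X in X \in _](tpermL u v) mem_imset; last exact: perm_inj.
by rewrite (negPf uT).
Qed.

End Clone.

(** The copies dropped in one clone, those through exactly one of [u] and [v], are the ones counted
    twice in the other, so the two bounds add up to twice the total. *)
Lemma unaligned_copies_symmetrization (V : finType) (e : rel V) (u v : V) :
  symmetric e -> irreflexive e -> u != v -> ~~ e u v ->
  complete_multipartite H ->
  (#|unaligned_copies e| + #|unaligned_copies e|
   <= #|unaligned_copies (clone u v e)| + #|unaligned_copies (clone v u e)|)%N.
Proof.
move=> e_sym e_irr uv e_uv mpH.
have := leq_unaligned_copies_clone e_sym e_irr uv e_uv mpH.
have := leq_unaligned_copies_clone (u := v) (v := u) e_sym e_irr.
rewrite eq_sym uv e_sym e_uv => /(_ isT isT mpH).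
set X := unaligned_copies e.
have split_card (a b : pred ({set V} * {set {set V}})) :
    (forall S, b S = ~~ a S) ->
    (#|[set S in X | a S]| + #|[set S in X | b S]| = #|X|)%N.
  move=> ab; rewrite -(cardsID [set S | a S] X); congr (_ + _)%N.
    by apply: eq_card => S; rewrite !inE.
  by apply: eq_card => S; rewrite !inE ab andbC.
have uE := split_card (fun S => (u \in S.1) ==> (v \in S.1))
  (fun S => (u \in S.1) && (v \notin S.1)) (fun S => esym (negb_imply _ _)).
have vE := split_card (fun S => (v \in S.1) ==> (u \in S.1))
  (fun S => (v \in S.1) && (u \notin S.1)) (fun S => esym (negb_imply _ _)).
rewrite addnC in vE; rewrite addnC => le_vu le_uv; have := leq_add le_uv le_vu.
by rewrite addnACA uE vE.
Qed.

End UnalignedCopies.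

(** * Degrees and edge counts under cloning *)

Section Degrees.
Variable V : finType.
Implicit Types (e : rel V) (u v : V).

Definition degree e u : nat := (\sum_y e u y)%N.
Definition double_edges e : nat := (\sum_x degree e x)%N.

Lemma double_edges_split e u : symmetric e -> irreflexive e ->
  double_edges e =
  ((\sum_(x | x != u) \sum_(y | y != u) e x y) + 2 * degree e u)%N.
Proof.
move=> e_sym e_irr.
have dE x : degree e x = (e u x + \sum_(y | y != u) e x y)%N.
  by rewrite /degree (bigD1 u) //= e_sym.
have du : degree e u = (\sum_(y | y != u) e u y)%N by rewrite dE e_irr.
rewrite /double_edges (bigD1 u) //= (eq_bigr _ (fun x _ => dE x)) big_split /=.
by rewrite -du addnA addnn -mul2n addnC.
Qed.

(** Only edges at [u] change: its degree becomes that of [v]. Written additively to avoid truncated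
    subtraction. *)
Lemma double_edges_clone e u v : symmetric e -> irreflexive e -> ~~ e u v ->
  (double_edges (clone u v e) + 2 * degree e u
   = double_edges e + 2 * degree e v)%N.
Proof.
move=> e_sym e_irr e_uv.
rewrite !(double_edges_split u) //; try exact: clone_sym; try exact: clone_irr.
have -> : degree (clone u v e) u = degree e v.
  apply: eq_bigr => y _; rewrite /clone /retarget eqxx.
  by have [->|//] := eqVneq y u; rewrite e_irr e_sym (negPf e_uv).
rewrite (eq_bigr (fun x => \sum_(y | y != u) e x y))%N; first by lia.
move=> x xu; apply: eq_bigr => y yu.
by rewrite /clone /retarget !ifN.
Qed.

(* Cloning [u] from [v] leaves the degree of [v] unchanged but costs [w] its
   edge to [u], so the degrees of [v] and [w] cannot be equal both times. *)
Lemma nonadjacency_trans (P : rel V -> Prop) e :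
  symmetric e -> irreflexive e -> P e ->
  (forall e u v, symmetric e -> irreflexive e -> P e -> u != v -> ~~ e u v ->
     degree e u = degree e v /\ P (clone u v e)) ->
  forall u w v, e u w -> e u v || e v w.
Proof.
move=> e_sym e_irr Pe step u w v uw; apply: contraLR uw.
rewrite negb_or => /andP[e_uv e_vw]; apply/negP => e_uw.
have uv : u != v by apply: contraNneq e_vw => <-.
have vw : v != w by apply: contraNneq e_uv => ->.
have wu : w != u by apply: contraTneq e_uw => ->; rewrite e_irr.
have [_ Pc] := step e u v e_sym e_irr Pe uv e_uv.
have [dvw _] := step e v w e_sym e_irr Pe vw e_vw.
have cvw : ~~ clone u v e v w.
  by rewrite /clone /retarget eq_sym (negPf uv) (negPf wu).
have [dcvw _] :=
  step _ v w (clone_sym u v e_sym) (clone_irr u v e_irr) Pc vw cvw.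
have dcv : degree (clone u v e) v = degree e v.
  apply: eq_bigr => y _; rewrite /clone /retarget eq_sym (negPf uv).
  by have [->|//] := eqVneq y u; rewrite e_irr e_sym (negPf e_uv).
have dcw : (degree (clone u v e) w).+1 = degree e w.
  rewrite /degree (bigD1 u) //= [RHS](bigD1 u) //=.
  rewrite /clone /retarget (negPf wu) eqxx e_sym (negPf e_vw) e_sym e_uw.
  rewrite add0n add1n; congr _.+1; apply: eq_bigr => y yu.
  by rewrite (negPf yu).
lia.
Qed.

End Degrees.

(** * From the given counts to unaligned copies *)

Lemma eq_set2_rel (V : finType) (r : rel V) (a b c d : V) :
  symmetric r -> [set a; b] = [set c; d] -> r a b = r c d.
Proof.
move=> r_sym eqS.
have : (c \in [set a; b]) && (d \in [set a; b]) by rewrite eqS set21 set22.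
have : (a \in [set c; d]) && (b \in [set c; d]) by rewrite -eqS set21 set22.
rewrite !inE => /andP[/orP[]/eqP-> /orP[]/eqP->] //.
  by rewrite !orbb => /andP[_ /eqP->].
by rewrite !orbb => /andP[/eqP->].
Qed.

(** Each member of [S.2] is a pair of vertices of [S.1], the image of [f], so it comes from an edge
    of [H]: the edge set is determined by [f]. *)
Lemma copiesE (H G : sgraph) :
  copies G H = [set S | is_copy H (sedge (s := G)) S].
Proof.
apply/setP => S; rewrite !inE; apply/andP/is_copyP => [[/forall_inP subG] |].
  move=> /existsP[f /and3P[/injectiveP fI /eqP fS /forallP fE]].
  have {}fE x y : sedge x y = ([set f x; f y] \in S.2).
    by move/forallP: (fE x) => /(_ y)/eqP.
  have edgeS a : a \in S.2 -> exists x y,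
      [/\ x \in S.1, y \in S.1, sedge x y & a = [set x; y]].
    move=> /subG /exists_inP[x xS /exists_inP[y yS /andP[xy /eqP->]]].
    by exists x, y.
  exists f; split=> // [|x y]; last first.
    by rewrite fE => /edgeS[a [b [_ _ ab /(eq_set2_rel (@sedge_sym G))->]]].
  rewrite [S]surjective_pairing /copy_of fS; congr (_, _); apply/setP => a.
  apply/idP/imsetP => [aS | [p]]; last by rewrite inE fE => pS ->.
  have [x [y [xS yS xy aE]]] := edgeS a aS.
  move: xS yS; rewrite -fS => /imsetP[x' _ xE] /imsetP[y' _ yE].
  by exists (x', y'); rewrite ?inE /= ?fE -xE -yE -aE.
move=> [f [fI -> fe]]; split.
  apply/forall_inP => _ /imsetP[p + ->]; rewrite inE => /fe pE.
  apply/exists_inP; exists (f p.1); first exact: imset_f.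
  apply/exists_inP; exists (f p.2); first exact: imset_f.
  by rewrite pE eqxx.
apply/existsP; exists [ffun x => f x]; apply/and3P; split.
- by apply/injectiveP => x y; rewrite !ffunE => /fI.
- by apply/eqP/eq_imset => x; rewrite ffunE.
apply/forallP => x; apply/forallP => y; rewrite !ffunE; apply/eqP.
apply/idP/imsetP => [xy | [p]]; first by exists (x, y); rewrite ?inE.
(* Injectivity of [f] recovers an edge of [H] from its image. *)
have im2 a b : [set f a; f b] = f @: [set a; b] by rewrite imsetU1 imset_set1.
rewrite inE !im2 => pE /(imset_inj fI) /(eq_set2_rel (@sedge_sym H)) ->.
by [].
Qed.

Lemma unalignedE (k : nat) (G : sgraph) (S : subgraph G) :
  [forall S' in copies G (complete_graph k.+1), ~~ align S S']
  = unaligned k (sedge (s := G)) S.1.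
Proof.
apply/forall_inP/unalignedP => [nS K /is_cliqueP[cK eK] | nK S'].
  (* Enumerating a clique makes it the vertex set of a copy of the complete graph. *)
  pose f (i : complete_graph k.+1) : G := enum_val (cast_ord (esym cK) i).
  have fI : injective f by move=> i j /enum_val_inj /cast_ord_inj.
  have <- : f @: [set: complete_graph k.+1] = K.
    apply/eqP; rewrite eqEcard card_imset // cardsT card_ord cK leqnn andbT.
    by apply/subsetP => _ /imsetP[i _ ->]; apply: enum_valP.
  apply/andP; rewrite -negb_or; apply: (nS (copy_of f)).
  rewrite copiesE inE; apply/is_copyP; exists f; split=> // i j ij.
  by apply: eK; rewrite ?enum_valP // (inj_eq fI).
rewrite copiesE inE => /is_copyP[f [fI -> fe]]; rewrite /align negb_or.
apply/andP/nK/is_cliqueP; split; first by rewrite card_imset // cardsT card_ord.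
by move=> _ _ /imsetP[i _ ->] /imsetP[j _ ->]; rewrite (inj_eq fI) => /fe.
Qed.

Lemma ncopies_reE (H : sgraph) (k : nat) (G : sgraph) :
  ncopies_re H (complete_graph k.+1) G
  = #|unaligned_copies H k (sedge (s := G))|.
Proof.
apply: eq_card => S; rewrite inE [RHS]inE -unalignedE.
by rewrite copiesE inE.
Qed.

(* A graph on [n] vertices has no clique of order [n.+1] to align with. *)
Lemma ncopiesE (H G : sgraph) :
  ncopies H G = #|unaligned_copies H #|G| (sedge (s := G))|.
Proof.
rewrite /ncopies copiesE; apply: eq_card => S; rewrite !inE.
rewrite (_ : unaligned _ _ _) ?andbT //; apply/unalignedP => K /is_cliqueP[cK].
by have := max_card (mem K); rewrite cK ltnn.
Qed.

(** * The objective and its lexicographic maximizers *)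

Lemma ex_lexicographic_max d (C : orderType d) (T : finType) (P : pred T)
    (X : T -> C) (Y : T -> nat) (t0 : T) : P t0 ->
  exists2 t, P t & forall t', P t' ->
    (X t' <= X t)%O /\ (X t' = X t -> (Y t' <= Y t)%N).
Proof.
move=> Pt0; have [t1 Pt1 maxX] := arg_maxP X Pt0.
have Q1 : P t1 && (X t1 == X t1) by rewrite Pt1 eqxx.
have [t /andP[Pt /eqP Xt] maxY] :=
  @arg_maxnP _ t1 (fun t => P t && (X t == X t1)) Y Q1.
exists t => // t' Pt'; rewrite Xt; split; first exact: maxX.
by move=> Xt'; apply: maxY; rewrite Pt' Xt' eqxx.
Qed.

Section Objective.
Variables (R : realType) (l m : nat) (H : 'I_l -> sgraph) (H' : 'I_m -> sgraph).
Variables (k : 'I_l -> nat) (alpha : 'I_l -> R) (beta : 'I_m -> R) (n : nat).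
Hypotheses (H_multipartite : forall i, complete_multipartite (H i))
  (H'_multipartite : forall j, complete_multipartite (H' j))
  (alpha_ge0 : forall i, 0 <= alpha i) (beta_ge0 : forall j, 0 <= beta j).

(** Plain copies are counted as copies unaligned with cliques of order [n.+1], so one symmetrization
    argument covers both sums. *)
Definition objective (V : finType) (e : rel V) : R :=
  \sum_(i < l) alpha i * #|unaligned_copies (H i) (k i) e|%:R
  + \sum_(j < m) beta j * #|unaligned_copies (H' j) n e|%:R.

Lemma le_objective_iso (V W : finType) (e : rel V) (e' : rel W) (g : V -> W) :
  bijective g -> (forall x y, e' (g x) (g y) = e x y) ->
  objective e <= objective e'.
Proof.
move=> gB g_mor; apply: lerD; apply: ler_sum => i _;
  by apply: ler_wpM2l => //; rewrite ler_nat; apply: leq_unaligned_copies g_mor.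
Qed.

Lemma eq_objective (V : finType) (e e' : rel V) :
  e =2 e' -> objective e = objective e'.
Proof.
have idB : bijective (@id V) by exists id.
move=> ee'; apply/eqP; rewrite eq_le.
by rewrite !(le_objective_iso idB) // => x y; rewrite ee'.
Qed.

Lemma objective_symmetrization (V : finType) (e : rel V) (u v : V) :
  symmetric e -> irreflexive e -> u != v -> ~~ e u v ->
  objective e + objective e
  <= objective (clone u v e) + objective (clone v u e).
Proof.
move=> e_sym e_irr uv e_uv; rewrite /objective addrACA [leRHS]addrACA.
rewrite -!big_split /=.
apply: lerD; apply: ler_sum => i _; rewrite -!mulrDr -!natrD ler_wpM2l //;
  by rewrite ler_nat unaligned_copies_symmetrization.
Qed.

Definition lexicographic_max (V : finType) (e : rel V) : Prop :=
  forall e' : rel V, symmetric e' -> irreflexive e' ->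
    objective e' <= objective e /\
    (objective e' = objective e -> (double_edges e' <= double_edges e)%N).

Lemma ex_lexicographic_max_graph (V : finType) :
  exists e : rel V,
    [/\ symmetric e, irreflexive e & lexicographic_max e].
Proof.
(* Finite functions encode relations in a finite type, where a maximum exists; the edgeless graph
   shows that the search space is nonempty. *)
pose dec (f : {ffun V * V -> bool}) : rel V := fun x y => f (x, y).
pose P f := [forall x, ~~ dec f x x] &&
            [forall x, forall y, dec f x y == dec f y x].
have decK (e : rel V) : dec [ffun p => e p.1 p.2] =2 e.
  by move=> x y; rewrite /dec ffunE.
have PP f : reflect (symmetric (dec f) /\ irreflexive (dec f)) (P f).
  apply: (iffP andP) => [[/forallP irr /forallP sym]|[sym irr]]; split.
  - by move=> x y; move/forallP: (sym x) => /(_ y)/eqP.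
  - by move=> x; apply/negbTE.
  - by apply/forallP => x; rewrite irr.
  - by apply/forallP => x; apply/forallP => y; rewrite sym.
have P0 : P [ffun=> false] by apply/PP; split=> x *; rewrite /dec !ffunE.
have [f /PP[sym irr] fmax] := ex_lexicographic_max
  (fun f => objective (dec f)) (fun f => double_edges (dec f)) P0.
exists (dec f); split=> // e e_sym e_irr.
have [|] := fmax [ffun p => e p.1 p.2].
  by apply/PP; split=> [x y|x]; rewrite !decK.
rewrite (eq_objective (decK e)) => le_obj le_edges; split=> // /le_edges.
congr (_ <= _)%N; apply: eq_bigr => x _; apply: eq_bigr => y _.
by rewrite decK.
Qed.

(** Neither clone beats [e], yet together they reach twice its objective, so both attain it. Their
    edge counts then cannot exceed that of [e], but change by opposite amounts, so neither changes
    and the degrees agree. *)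
Lemma lexicographic_max_clone (V : finType) (e : rel V) (u v : V) :
  symmetric e -> irreflexive e -> lexicographic_max e -> u != v -> ~~ e u v ->
  degree e u = degree e v /\ lexicographic_max (clone u v e).
Proof.
move=> e_sym e_irr e_max uv e_uv; have e_vu : ~~ e v u by rewrite e_sym.
have [obj_uv edg_uv] := e_max _ (clone_sym u v e_sym) (clone_irr u v e_irr).
have [obj_vu edg_vu] := e_max _ (clone_sym v u e_sym) (clone_irr v u e_irr).
have obj2 := objective_symmetrization e_sym e_irr uv e_uv.
have obj_uvE : objective (clone u v e) = objective e by lra.
have obj_vuE : objective (clone v u e) = objective e by lra.
have edges_uv := double_edges_clone e_sym e_irr e_uv.
have edges_vu := double_edges_clone e_sym e_irr e_vu.
have {}edg_uv := edg_uv obj_uvE; have {}edg_vu := edg_vu obj_vuE.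
have deg : degree e u = degree e v by lia.
split=> // e' e'_sym e'_irr; rewrite obj_uvE.
have -> : double_edges (clone u v e) = double_edges e by lia.
exact: e_max.
Qed.

End Objective.

Theorem theorem1p7 (R : realType) (l m : nat)
    (H : 'I_l -> sgraph) (H' : 'I_m -> sgraph) (k : 'I_l -> nat)
    (alpha : 'I_l -> R) (beta : 'I_m -> R)
    (H_multipartite : forall i, complete_multipartite (H i))
    (H'_multipartite : forall j, complete_multipartite (H' j))
    (k_gt0 : forall i, (0 < k i)%N)
    (alpha_ge0 : forall i, 0 <= alpha i)
    (beta_ge0 : forall j, 0 <= beta j) :
  let x (G : sgraph) : R :=
    \sum_(i < l) alpha i * (ncopies_re (H i) (complete_graph (k i).+1) G)%:R
    + \sum_(j < m) beta j * (ncopies (H' j) G)%:R in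
  forall n : nat, exists T : sgraph,
    [/\ #|T| = n, complete_multipartite T &
        forall G : sgraph, #|G| = n -> x G <= x T].
Proof.
move=> x n.
have xE (G : sgraph) :
    #|G| = n -> x G = objective H H' k alpha beta n (sedge (s := G)).
  move=> cG; rewrite /x /objective; congr (_ + _); apply: eq_bigr => i _.
    by rewrite ncopies_reE.
  by rewrite ncopiesE cG.
have [e [e_sym e_irr e_max]] :=
  ex_lexicographic_max_graph H H' k n alpha_ge0 beta_ge0 'I_n.
exists (SGraph e_sym e_irr); split; first exact: card_ord.
  apply/complete_multipartiteP => u w v /=.
  (* The property preserved by cloning is lexicographic maximality. *)
  apply: (nonadjacency_trans e_sym e_irr e_max) => *.
  exact: lexicographic_max_clone.
move=> G cG; rewrite !xE ?card_ord //=.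
pose g (i : 'I_n) : G := enum_val (cast_ord (esym cG) i).
pose h (y : G) : 'I_n := cast_ord cG (enum_rank y).
have gK : cancel g h.
  by move=> i; rewrite /g /h enum_valK cast_ordKV.
have hK : cancel h g.
  by move=> y; rewrite /g /h cast_ordK enum_rankK.
(* An arbitrary [G] is pulled back to ['I_n], where [e] is maximal. *)
pose eG : rel 'I_n := fun i j => sedge (g i) (g j).
have [|i|le_eG _] := e_max eG; [by move=> i j; apply: sedge_sym | |].
  exact: sedge_irrefl.
apply: le_trans le_eG; have hB : bijective h by exists g.
by apply: le_objective_iso hB _ => // y z; rewrite /eG !hK.
Qed.
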